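(* Let $n,k$ be integers with $2\le k\le n$, and let $S_{n,k}$ be the set of all permutations in $S_n$ with weight $k$. Suppose $f:S_{n,k}\to\mathbb R$ satisfies $$|f(\sigma)-f(\tau)|\le\Delta(\sigma,\tau)\quad\text{for all }\sigma,\tau\in S_{n,k}.$$ Let $\boldsymbol\sigma$ be drawn uniformly at random from $S_{n,k}$. Then $$\mathbb P\bigl(|f(\boldsymbol\sigma)-\mathbb Ef(\boldsymbol\sigma)|\ge t\bigr)\le2\exp\left(-\frac{t^2}{72k}\right)\quad\text{for all }t\ge0.$$
   Context: $S_n$ is the symmetric group on $[n]$; $\Delta(\sigma,\tau)=|\{i\in[n]:\sigma(i)\ne\tau(i)\}|$ is the Hamming distance. The weight of a permutation is its Hamming distance to the identity. *)

(* Defs.v *)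
From HB Require Import structures.
From mathcomp Require Import all_boot all_order all_algebra all_fingroup.
From mathcomp Require Import all_reals all_analysis.
Set Implicit Arguments.
Unset Strict Implicit.
Unset Printing Implicit Defensive.
Import Order.TTheory GRing.Theory Num.Theory.
Local Open Scope ring_scope.

Definition hamming (n : nat) (s t : 'S_n) : nat := #|[set i | s i != t i]|.

Definition weight (n : nat) (s : 'S_n) : nat := hamming s 1%g.

Definition perms_of_weight (n k : nat) : {set 'S_n} :=
  [set s | weight s == k].

(* Uniform distribution on a finite set A, which is meant to be nonempty: since
   0^-1 = 0, both quantities below are 0 when A is empty. *)
Definition unif_prob (R : realType) (T : finType) (A : {set T}) (E : pred T)
  : R := #|[set x in A | E x]|%:R / #|A|%:R.

Definition unif_expect (R : realType) (T : finType) (A : {set T}) (f : T -> R)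
  : R := (\sum_(x in A) f x) / #|A|%:R.

(* Main.v *)
Require Import Defs.
From HB Require Import structures.
From mathcomp Require Import all_boot all_order all_algebra all_fingroup.
From mathcomp Require Import all_reals all_analysis.
From mathcomp Require Import ring lra zify.
Set Implicit Arguments.
Unset Strict Implicit.
Unset Printing Implicit Defensive.
Import Order.TTheory GRing.Theory Num.Theory.
Local Open Scope ring_scope.

(** The proof is an exponential-moment martingale argument in which a random
permutation of weight [k] is revealed in [2 k] steps: first the points that it
moves, one after the other, and then its values at these points. Each step
changes the conditional expectation of [f] by a quantity that ranges over an
interval of length at most 4, so that [f] is subgaussian with variance proxy
[2 k * 4 ^ 2 = 32 k], and Chernoff's bound gives the tail
[2 exp (- t^2 / (64 k))], which is stronger than the one claimed.

The martingale is never written down. A step says that a finite set [D] is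
covered uniformly by subsets on which [f] is subgaussian with proxy [V] and
whose means differ by at most [L]; then [f] is subgaussian on [D] with proxy
[V + L^2] ([subgaussian_mixture]). The theorem follows by iterating this.

Revealing a moved point [a] rather than [b]: conjugation by the transposition
of [a] and [b] matches the two conditional laws and changes a permutation in
at most 4 places ([subgaussian_moved_supset]).

Revealing the value [x] rather than [y] at a point [i], given the set [A] of
moved points and the values on [P] ([next_value_gap]): the undetermined points
may be mapped freely to an element of [P], whereas an element outside [P] is
itself an undetermined point and must not be mapped to itself. When [x] and
[y] are of the same kind, composing or conjugating with their transposition
matches the two laws. When only [y] belongs to [P], composition
matches the law of [y] with the law of [x] conditioned on [x] not being mapped
to [y]. The exceptional event has probability about [1 / N], where [N] is the
number of points of [A] whose values are unknown ([card_chord]), while two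
permutations from these laws are never at distance more than [N]; the event
thus moves the mean by a bounded amount. *)

(** * Exponential moments *)

Lemma fact_double_ge m : (2 ^ m * m`! <= (m.*2)`!)%N.
Proof.
elim: m => [//|m IH].
rewrite doubleS !factS expnS.
nia.
Qed.

(** The bound [cosh u <= exp (u^2 / 2)]: it holds term by term for the power
series, because [2^m m! <= (2m)!]. *)
Lemma expR_add_expRN_le (R : realType) (u : R) :
  expR u + expR (- u) <= 2 * expR (u ^+ 2 / 2).
Proof.
pose h := series (exp_coeff u) \+ series (exp_coeff (- u)).
have hS m : h m.+1 = h m + (exp_coeff u m + exp_coeff (- u) m).
  by rewrite /h /= !seriesSr addrACA.
have coeffD m : exp_coeff u m + exp_coeff (- u) m =
    if odd m then 0 else 2 * (u ^+ m / m`!%:R).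
  rewrite /exp_coeff /= exprNn -signr_odd; case: (odd m) => /=.
    by rewrite expr1 mulN1r mulNr subrr.
  by rewrite expr0 mul1r mulr_natl mulr2n.
have coeff_ge0 m : 0 <= exp_coeff u m + exp_coeff (- u) m.
  rewrite coeffD; case: ifPn => // modd.
  by rewrite mulr_ge0// divr_ge0// exprn_even_ge0.
have h_mono : {homo h : m p / (m <= p)%N >-> m <= p}.
  by apply: homo_leq => // [? ? ?|m]; [exact: le_trans | rewrite hS lerDl].
(* Odd terms cancel in [h], so [2m] of its terms face [m] terms on the right. *)
have h_double m : h m.*2 <= 2 * series (exp_coeff (u ^+ 2 / 2)) m.
  elim: m => [|m IH].
    by rewrite /h /= !seriesEnat /= !big_geq// addr0 mulr0.
  rewrite doubleS !hS seriesSr mulrDr -addrA lerD// !coeffD /= odd_double/=.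
  rewrite addr0 ler_pM2l// /exp_coeff /= -mul2n exprM expr_div_n -[leRHS]mulrA.
  rewrite ler_wpM2l//; first by apply: exprn_ge0; exact: sqr_ge0.
  rewrite -invfM lef_pV2 ?posrE.
  - by rewrite -natrX -natrM ler_nat mul2n fact_double_ge.
  - by rewrite ltr0n fact_gt0.
  - by rewrite mulr_gt0// ?exprn_gt0// ltr0n fact_gt0.
have series_le m : series (exp_coeff (u ^+ 2 / 2)) m <= expR (u ^+ 2 / 2).
  apply: nondecreasing_cvgn_le; last exact: is_cvg_series_exp_coeff.
  apply/nondecreasing_seqP => k; rewrite seriesSr lerDl.
  by rewrite exp_coeff_ge0// divr_ge0// sqr_ge0.
rewrite /expR -limD; try exact: is_cvg_series_exp_coeff.
apply: limr_le.
  by apply: is_cvgD; exact: is_cvg_series_exp_coeff.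
apply: nearW => m; apply: (le_trans (h_mono _ m.*2 _)); first by lia.
by rewrite (le_trans (h_double m))// ler_pM2l.
Qed.

(** Hoeffding's lemma by symmetrization: Jensen's inequality replaces the mean
[m] by an independent copy of [g], and the difference of two copies is
symmetric, so that its exponential moments are those of a [cosh]. This loses a
factor 4 in the exponent against the sharp form. *)
Lemma weighted_hoeffding (R : realType) (J : finType) (P : pred J)
    (w g : J -> R) (W m L l : R) :
    (forall j, P j -> 0 <= w j) ->
    \sum_(j | P j) w j = W -> 0 < W -> \sum_(j | P j) w j * g j = W * m ->
    (forall i j, P i -> P j -> `|g i - g j| <= L) ->
  \sum_(j | P j) w j * expR (l * (g j - m)) <= W * expR (l ^+ 2 * L ^+ 2 / 2).
Proof.
move=> w_ge0 sumw W_gt0 sumwg gL.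
pose ex i j := expR (l * (g i - g j)).
(* Jensen's inequality, from [expR z >= 1 + z] and the centering of [g]. *)
have jensen i : W * expR (l * (g i - m)) <= \sum_(j | P j) w j * ex i j.
  have -> : \sum_(j | P j) w j * ex i j =
      expR (l * (g i - m)) * \sum_(j | P j) w j * expR (l * (m - g j)).
    rewrite mulr_sumr; apply: eq_bigr => j _; rewrite mulrCA -expRD /ex.
    by congr (_ * expR _); ring.
  rewrite mulrC ler_pM2l ?expR_gt0//.
  have <- : \sum_(j | P j) w j * (1 + l * (m - g j)) = W.
    rewrite (eq_bigr (fun j => (1 + l * m) * w j - l * (w j * g j)));
      last by move=> j _; ring.
    by rewrite sumrB -!mulr_sumr sumw sumwg; ring.
  by apply: ler_sum => j Pj; rewrite ler_wpM2l ?w_ge0// expR_ge1Dx.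
rewrite -(ler_pM2l W_gt0) mulr_sumr.
pose S := \sum_(i | P i) \sum_(j | P j) w i * w j * ex i j.
apply: (@le_trans _ _ S).
  apply: ler_sum => i Pi; rewrite mulrCA.
  under [leRHS]eq_bigr do rewrite -mulrA.
  by rewrite -mulr_sumr ler_wpM2l ?w_ge0.
(* Adding [S] to itself with the two indices exchanged pairs [expR u] with
   [expR (- u)]. *)
suff : S + S <= 2 * (W * (W * expR (l ^+ 2 * L ^+ 2 / 2))) by lra.
have {1}-> : S = \sum_(i | P i) \sum_(j | P j) w i * w j * ex j i.
  rewrite /S exchange_big /=; apply: eq_bigr => i _.
  by apply: eq_bigr => j _; rewrite [w i * _]mulrC.
rewrite -big_split /= -{1}sumw mulr_suml mulr_sumr.
apply: ler_sum => i Pi; rewrite -big_split /= -sumw mulr_suml !mulr_sumr.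
apply: ler_sum => j Pj; rewrite -mulrDr mulrCA -mulrA.
rewrite ler_wpM2l ?w_ge0// mulrCA ler_wpM2l ?w_ge0//.
have -> : ex i j = expR (- (l * (g j - g i))) by congr expR; ring.
apply: (le_trans (expR_add_expRN_le _)).
rewrite ler_pM2l// ler_expR ler_pM2r ?invr_gt0// exprMn ler_wpM2l ?sqr_ge0//.
have := gL _ _ Pj Pi; rewrite ler_norml; nra.
Qed.

(** The bound [E exp (l (f - E f)) <= exp (l^2 V / 2)] for the uniform law on
[D], multiplied by [#|D|] so that it also makes sense when [D] is empty. *)
Definition subgaussian (R : realType) (T : finType) (D : {set T}) (f : T -> R)
    (V : R) :=
  forall l, \sum_(x in D) expR (l * (f x - unif_expect D f))
            <= #|D|%:R * expR (l ^+ 2 * V / 2).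

Section Uniform.
Variables (R : realType) (T : finType).
Implicit Types (D : {set T}) (f : T -> R).

Lemma sum_unif_expect D f : \sum_(x in D) f x = #|D|%:R * unif_expect D f.
Proof.
rewrite /unif_expect mulrC; have [->|D_neq0] := eqVneq D set0.
  by rewrite big_set0 !mul0r.
by rewrite divfK// pnatr_eq0 cards_eq0.
Qed.

(** One martingale step. As every point of [D] lies in exactly [c] of the sets
[Dj j], choosing [j] with probability proportional to [#|Dj j|] and then a
uniform point of [Dj j] produces the uniform law on [D]: the exponential moment
factors into that of [f] inside [Dj j] and that of the conditional mean.
Allowing [c > 1] lets one reveal an element of a random set, as well as the
value of a function (where [c = 1]). *)
Lemma subgaussian_mixture (J : finType) (P : pred J) (Dj : J -> {set T})
    D f (c : nat) (V L : R) :
    (0 < c)%N ->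
    (forall j, P j -> Dj j \subset D) ->
    (forall x, x \in D -> #|[set j | P j && (x \in Dj j)]| = c) ->
    (forall j, P j -> subgaussian (Dj j) f V) ->
    (forall i j, P i -> P j ->
       `|unif_expect (Dj i) f - unif_expect (Dj j) f| <= L) ->
  subgaussian D f (V + L ^+ 2).
Proof.
move=> c_gt0 DjD cover Vj Lij l.
have count (h : T -> R) :
    \sum_(j | P j) \sum_(x in Dj j) h x = c%:R * \sum_(x in D) h x.
  rewrite (exchange_big_dep (mem D)) => [|j x Pj]; last exact/subsetP/DjD.
  rewrite mulr_sumr; apply: eq_bigr => x xD.
  by rewrite sumr_const mulr_natl -(cover x xD) cardsE.
have [->|D_neq0] := eqVneq D set0; first by rewrite big_set0 cards0 mul0r.
have D_gt0 : 0 < #|D|%:R :> R by rewrite ltr0n card_gt0.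
have c_gt0' : 0 < c%:R :> R by rewrite ltr0n.
pose m := unif_expect D f; pose mj j := unif_expect (Dj j) f.
have sumw : \sum_(j | P j) #|Dj j|%:R = c%:R * #|D|%:R :> R.
  rewrite -sumr_const -count; apply: eq_bigr => j _.
  by rewrite sumr_const.
have sumwm : \sum_(j | P j) #|Dj j|%:R * mj j = c%:R * #|D|%:R * m.
  rewrite -mulrA -sum_unif_expect -count; apply: eq_bigr => j _.
  by rewrite sum_unif_expect.
have H := weighted_hoeffding l (fun j _ => ler0n R #|Dj j|) sumw
  (mulr_gt0 c_gt0' D_gt0) sumwm Lij.
rewrite -(ler_pM2l c_gt0') -count.
apply: (@le_trans _ _ (\sum_(j | P j)
    expR (l ^+ 2 * V / 2) * (#|Dj j|%:R * expR (l * (mj j - m))))).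
  apply: ler_sum => j Pj.
  have split_mean x : l * (f x - unif_expect D f) =
      l * (mj j - m) + l * (f x - mj j) by rewrite /m; ring.
  under eq_bigr => x _ do rewrite split_mean expRD.
  rewrite -mulr_sumr [leRHS]mulrA [leRHS]mulrC ler_pM2l ?expR_gt0//.
  by rewrite [leRHS]mulrC; exact: Vj.
rewrite -mulr_sumr (_ : l ^+ 2 * (V + L ^+ 2) / 2 =
  l ^+ 2 * V / 2 + l ^+ 2 * L ^+ 2 / 2); last by ring.
rewrite expRD [#|D|%:R * _]mulrCA [c%:R * _]mulrCA ler_pM2l ?expR_gt0//.
by rewrite mulrA.
Qed.

(** Chernoff's bound, with the optimal parameter [t / V]. *)
Lemma subgaussian_tail D f (V t : R) : 0 < V -> 0 <= t -> subgaussian D f V ->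
  #|[set x in D | t <= f x - unif_expect D f]|%:R
    <= #|D|%:R * expR (- (t ^+ 2 / (2 * V))).
Proof.
move=> V_gt0 t_ge0 /(_ (t / V)); set m := unif_expect D f => mgf.
rewrite -(ler_pM2r (expR_gt0 (t ^+ 2 / V))).
have -> : #|D|%:R * expR (- (t ^+ 2 / (2 * V))) * expR (t ^+ 2 / V) =
    #|D|%:R * expR ((t / V) ^+ 2 * V / 2).
  rewrite -mulrA -expRD; congr (_ * expR _); field.
  by rewrite gt_eqF.
apply: le_trans mgf.
rewrite -sumr_const mulr_suml big_mkcond [leRHS]big_mkcond /=.
apply: ler_sum => x _; rewrite inE; case: (x \in D) => //=.
case: ifPn => [tle|_]; last exact: expR_ge0.
rewrite mul1r ler_expR expr2 mulrAC; apply: ler_wpM2l => //.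
by rewrite divr_ge0// ltW.
Qed.

Lemma unif_expectN D f : unif_expect D (fun x => - f x) = - unif_expect D f.
Proof. by rewrite /unif_expect sumrN mulNr. Qed.

Lemma subgaussianN D f V :
  subgaussian D f V -> subgaussian D (fun x => - f x) V.
Proof.
move=> mgf l; have := mgf (- l); rewrite sqrrN; apply: le_trans.
rewrite le_eqVlt; apply/orP; left; apply/eqP.
by apply: eq_bigr => x _; rewrite unif_expectN; congr expR; ring.
Qed.

Lemma subgaussian_two_sided_tail D f (V t : R) :
    0 < V -> 0 <= t -> subgaussian D f V ->
  unif_prob R D (fun x => t <= `|f x - unif_expect D f|)
    <= 2 * expR (- (t ^+ 2 / (2 * V))).
Proof.
move=> V_gt0 t_ge0 mgf; have := subgaussian_tail V_gt0 t_ge0 (subgaussianN mgf).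
have := subgaussian_tail V_gt0 t_ge0 mgf; rewrite unif_expectN /unif_prob.
set m := unif_expect D f; set X := [set _ | _].
set Y := [set _ | _ & _ <= _ - - _].
set Z := [set _ in D | _] => HX HY; set e := expR _.
have [->|D_neq0] := eqVneq #|D|%:R (0 : R).
  by rewrite invr0 mulr0 mulr_ge0// expR_ge0.
have D_gt0 : 0 < #|D|%:R :> R by rewrite lt_neqAle eq_sym D_neq0 ler0n.
rewrite ler_pdivrMr//.
have ZXY : (#|Z| <= #|X| + #|Y|)%N.
  rewrite (leq_trans _ (leq_card_setU X Y))//; apply/subset_leq_card/subsetP.
  move=> x; rewrite !inE => /andP[-> /=]; rewrite ler_normr opprK.
  by rewrite opprB addrC [- f x + m]addrC.
have : #|Z|%:R <= #|X|%:R + #|Y|%:R :> R by rewrite -natrD ler_nat.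
by rewrite -/e in HX HY *; lra.
Qed.

(** The involution [p] couples the two uniform laws, moving [f] by at most
[c]. *)
Lemma unif_expect_involution D1 D2 f (p : T -> T) (c : R) : 0 <= c ->
    involutive p ->
    {in D1, forall x, p x \in D2} -> {in D2, forall x, p x \in D1} ->
    {in D1, forall x, `|f x - f (p x)| <= c} ->
  `|unif_expect D1 f - unif_expect D2 f| <= c.
Proof.
move=> c_ge0 pK p12 p21 fp.
have imD : p @: D1 = D2.
  apply/setP => y; apply/imsetP/idP => [[x xD ->]|yD]; first exact: p12.
  by exists (p y); [exact: p21 | rewrite pK].
have pinj : {in D1 &, injective p} by move=> x y _ _; exact: (inv_inj pK).
rewrite /unif_expect -imD card_in_imset// big_imset// -mulrBl -sumrB.
have [->|D_neq0] := eqVneq #|D1|%:R (0 : R).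
  by rewrite invr0 mulr0 normr0.
have D_gt0 : 0 < #|D1|%:R :> R by rewrite lt_neqAle eq_sym D_neq0 ler0n.
rewrite normrM normfV [`|#|_|%:R|]ger0_norm// ler_pdivrMr//.
apply: (le_trans (ler_norm_sum _ _ _)).
rewrite mulrC mulr_natl -sumr_const; exact: ler_sum.
Qed.

End Uniform.
(** * Transpositions acting on permutations with prescribed moved points *)

Section Permutations.
Variable n : nat.
Implicit Types (s t pi : 'S_n) (A B P : {set 'I_n}).

Definition moved s : {set 'I_n} := [set i | s i != i].

Lemma weightE s : weight s = #|moved s|.
Proof. by rewrite /weight /hamming; under eq_finset do rewrite perm1. Qed.

Lemma hamming_le s t (X : {set 'I_n}) :
  (forall i, i \notin X -> s i = t i) -> (hamming s t <= #|X|)%N.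
Proof.
move=> eq_st; apply/subset_leq_card/subsetP => i; rewrite inE.
by apply: contraNT => /eq_st ->.
Qed.

Lemma hamming_mul_tperm s x y : (hamming s (s * tperm x y) <= 2)%N.
Proof.
pose X := [set (s^-1)%g x; (s^-1)%g y].
apply: (@leq_trans #|X|); last by rewrite cards2; case: eqP.
apply: hamming_le => i; rewrite !inE -!(canF_eq (permK s)) => /norP[ix iy].
by rewrite permM tpermD // eq_sym.
Qed.

Lemma conj_tpermE s x y i : (s ^ tperm x y)%g i = tperm x y (s (tperm x y i)).
Proof. by rewrite conjgE tpermV !permM. Qed.

Lemma conj_tperm_involutive x y : involutive (fun s => s ^ tperm x y)%g.
Proof. by move=> s; rewrite -conjgM tperm2 conjg1. Qed.

Lemma mul_tperm_involutive x y : involutive (fun s => s * tperm x y)%g.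
Proof. by move=> s; rewrite -mulgA tperm2 mulg1. Qed.

Lemma hamming_conj_tperm s x y : (hamming s (s ^ tperm x y) <= 4)%N.
Proof.
pose X := [set (s^-1)%g x; (s^-1)%g y] :|: [set x; y].
apply: (@leq_trans #|X|).
  apply: hamming_le => i; rewrite !inE -!(canF_eq (permK s)).
  rewrite !negb_or => /andP[/andP[ix iy] /andP[ix' iy']].
  by rewrite conj_tpermE (@tpermD _ x y i) ?tpermD // eq_sym.
apply: (leq_trans (leq_card_setU _ _)).
by rewrite !cards2; do 2 case: eqP.
Qed.

Lemma moved_conj s t : moved (s ^ t)%g = t @: moved s.
Proof.
apply/setP => i; rewrite -[i](permKV t) mem_imset ?inE; last exact: perm_inj.
by rewrite permJ (inj_eq perm_inj).
Qed.

Lemma conj_moved s x y A :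
  x \in A -> y \in A -> moved s = A -> moved (s ^ tperm x y)%g = A.
Proof.
move=> xA yA sA; rewrite moved_conj sA; apply/eqP.
rewrite eqEcard card_imset ?leqnn ?andbT; last exact: perm_inj.
by apply/subsetP => _ /imsetP[i iA ->]; case: tpermP => // ->.
Qed.

Definition cylinder A P pi : {set 'S_n} :=
  [set s | (moved s == A) && [forall (i | i \in P), s i == pi i]].

Lemma cylinderP A P pi s :
  reflect (moved s = A /\ {in P, s =1 pi}) (s \in cylinder A P pi).
Proof.
rewrite inE; apply: (iffP andP) => [[/eqP -> /'forall_implyP sP]|[-> sP]].
  by split=> // i /sP/eqP.
by split=> //; apply/'forall_implyP => i iP; rewrite sP.
Qed.

(** * Sensitivity of the mean to one more value *)

Section Lipschitz.
Variables (R : realType) (f : 'S_n -> R).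

Definition hamming_lipschitz (D : {set 'S_n}) :=
  {in D &, forall s t, `|f s - f t| <= (hamming s t)%:R}.

Section OneMoreValue.
Variables (A P : {set 'I_n}) (pi : 'S_n) (i : 'I_n).
Hypotheses (f_lip : hamming_lipschitz [set s | moved s == A]).
Hypotheses (iA : i \in A) (iP : i \notin P).

Let D x := [set s in cylinder A P pi | s i == x].

Let DP x s :
  reflect [/\ moved s = A, {in P, s =1 pi} & s i = x] (s \in D x).
Proof.
rewrite inE; apply: (iffP andP) => [[/cylinderP[? ?] /eqP]|[? ? ->]] //.
by rewrite eqxx; split=> //; apply/cylinderP.
Qed.

(** Every value that an element of the cylinder takes at [i] is of this kind. *)
Let available x := [/\ x \in A, x != i & forall p, p \in P -> pi p != x].

Let lipD x y s t c : s \in D x -> t \in D y -> (hamming s t <= c)%N ->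
  `|f s - f t| <= c%:R.
Proof.
move=> /DP[sA _ _] /DP[tA _ _] le_c.
by rewrite (le_trans (f_lip _ _)) ?inE ?sA ?tA// ler_nat.
Qed.

Let conj_mem x y s : available x -> available y -> x \notin P -> y \notin P ->
  s \in D x -> (s ^ tperm x y)%g \in D y.
Proof.
move=> [xA xi xpi] [yA yi ypi] xP yP /DP[sA sP six].
apply/DP; split.
- exact: conj_moved.
- move=> p pP; have px : x != p by apply: contraNneq xP => ->.
  have py : y != p by apply: contraNneq yP => ->.
  by rewrite conj_tpermE [tperm x y p]tpermD// sP// tpermD// eq_sym ?xpi ?ypi.
- by rewrite conj_tpermE [tperm x y i]tpermD// six tpermL.
Qed.

(** Composition with the transposition sends [i] to [y], and redirects to [x]
the point that [s] maps to [y]. The disjunction says that this point is not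
[x] itself, which would otherwise become a fixed point. *)
Let mul_mem x y s : available x -> available y -> x \in P \/ s x != y ->
  s \in D x -> (s * tperm x y)%g \in D y.
Proof.
move=> [xA xi xpi] [yA yi ypi] sx /DP[sA sP six].
have mulE j : (s * tperm x y)%g j = tperm x y (s j) by rewrite permM.
apply/DP; split.
- apply/setP => j; rewrite inE mulE -sA inE.
  have [sjx|sjx] := eqVneq (s j) x.
    have -> : j = i by apply: (@perm_inj _ s); rewrite sjx six.
    by rewrite six tpermL yi xi.
  have [sjy|sjy] := eqVneq (s j) y; last by rewrite tpermD// eq_sym.
  rewrite sjy tpermR.
  have -> : x != j.
    apply/eqP => xj; subst j.
    case: sx => [xP|]; last by rewrite sjy eqxx.
    by have := ypi x xP; rewrite -sP// sjy eqxx.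
  apply/esym; move: yA; rewrite -sA inE; apply: contraNneq => yj.
  by rewrite yj sjy yj.
- by move=> p pP; rewrite mulE sP// tpermD// eq_sym ?xpi ?ypi.
- by rewrite mulE six tpermL.
Qed.

Let lip_crude x y s t : s \in D x -> t \in D y ->
  `|f s - f t| <= #|A :\: P|%:R.
Proof.
move=> sD tD; apply: (lipD sD tD); apply: hamming_le => j.
move: sD tD => /DP[sA sP _] /DP[tA tP _].
rewrite inE negb_and negbK => /orP[jP|jA]; first by rewrite sP// tP.
have: j \notin moved s by rewrite sA.
have: j \notin moved t by rewrite tA.
by rewrite !inE !negbK => /eqP -> /eqP ->.
Qed.

(** If [s] maps [i] to [x] and [x] to [y], then for every undetermined point [j]
other than [i] and [x], the values of [s] at [x] and [j] can be exchanged: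
[j] is now mapped to [y], which is legitimate because [y] belongs to [P] and
[j] does not. As [j] is recovered as the preimage of [y], this is injective in
[s] and [j], and each permutation with [s x = y] accounts for
[#|A :\: P| - 2] others. *)
Let card_chord x y : available x -> available y -> x \notin P -> y \in P ->
  (#|[set s in D x | s x == y]| * #|A :\: P| <=
   #|[set s in D x | s x != y]| + 2 * #|[set s in D x | s x == y]|)%N.
Proof.
move=> [xA xi xpi] [yA yi ypi] xP yP; set E2 := [set _ in _ | _ == _].
set E1 := [set _ in _ | _ != _]; pose X := A :\: P :\ i :\ x.
have cardX : #|A :\: P| = #|X|.+2.
  by rewrite (cardsD1 i) (cardsD1 x (_ :\ i)) !inE xi iA iP xA xP.
pose ins (p : 'S_n * 'I_n) := (tperm x p.2 * p.1)%g.
have insE2 s j : s \in E2 -> ins (s, j) j = y.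
  by rewrite inE /ins permM tpermR => /andP[_ /eqP].
have ins_inj : {in setX E2 X &, injective ins}.
  move=> [s j] [s' j']; rewrite !in_setX => /andP[sE _] /andP[sE' _] eq_ins.
  have jj' : j = j'.
    by apply: (@perm_inj _ (ins (s, j))); rewrite insE2// eq_ins insE2.
  by move: eq_ins; rewrite /ins jj' /= => /mulgI ->.
have insE1 : ins @: setX E2 X \subset E1.
  apply/subsetP => _ /imsetP[[s j] /setXP[/= sE jX] ->].
  have sj := insE2 _ j sE.
  move: sE jX; rewrite !inE.
  move=> /andP[/andP[/andP[/eqP sA /forallP sP] six] /eqP sx].
  move=> /and4P[jx ji jP jA]; rewrite -!andbA.
  have sjx : s j != x by rewrite -(eqP six) (inj_eq perm_inj).
  have insx : ins (s, j) x = s j by rewrite permM tpermL.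
  have insz z : z != x -> z != j -> ins (s, j) z = s z.
    by move=> zx zj; rewrite permM tpermD// eq_sym.
  apply/and4P; split.
  - apply/eqP/setP => z; rewrite inE.
    have [->|zx] := eqVneq z x; first by rewrite insx sjx xA.
    have [->|zj] := eqVneq z j.
      by rewrite sj jA; apply: contraNneq jP => <-.
    by rewrite insz// -sA inE.
  - apply/'forall_implyP => p pP; have := sP p; rewrite pP /= insz//.
      by apply: contraNneq xP => <-.
    by apply: contraNneq jP => <-.
  - by rewrite insz// eq_sym.
  - by rewrite insx -sx (inj_eq perm_inj).
have := subset_leq_card insE1; rewrite card_in_imset// cardsX cardX.
by move=> le_E1; rewrite 2!mulnS mul2n -addnn [leqRHS]addnC addnA leq_add2l.
Qed.

(** On the part [E1] of [D x] matched with [D y] the means differ by at most 2;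
a permutation of the other part [E2] deviates from the mean over [D y] by at
most [#|A :\: P|], and by [card_chord] the proportion of such permutations is
roughly the inverse of that number. *)
Let gap_mixed x y : available x -> available y -> x \notin P -> y \in P ->
  D x != set0 -> D y != set0 ->
  `|unif_expect (D x) f - unif_expect (D y) f| <= 4.
Proof.
move=> ax ay xP yP Dx0 /set0Pn[t0 t0D].
have Dx_gt0 : 0 < #|D x|%:R :> R by rewrite ltr0n card_gt0.
set m := unif_expect (D y) f.
pose E1 := [set s in D x | s x != y]; pose E2 := [set s in D x | s x == y].
have E1m : `|unif_expect E1 f - m| <= 2.
  apply: (unif_expect_involution (p := fun s => s * tperm x y)%g) => //.
  - exact: mul_tperm_involutive.
  - by move=> s /setIdP[sD sx]; apply: mul_mem => //; right.
  - move=> s sD; rewrite [tperm _ _]tpermC inE mul_mem//=; last by left.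
    rewrite permM; move: (sD) => /DP[sA _ _].
    have : x \in moved s by rewrite sA; case: ax.
    by rewrite inE (inv_eq (tpermK _ _)) tpermL.
  - move=> s /setIdP[sD sx]; apply: (lipD sD _ (hamming_mul_tperm s x y)).
    by apply: mul_mem => //; right.
have E2m s : s \in E2 -> `|f s - m| <= #|A :\: P|%:R.
  move=> /setIdP[sD _]; have Dy_gt0 : 0 < #|D y|%:R :> R.
    by rewrite ltr0n card_gt0; apply/set0Pn; exists t0.
  rewrite -(ler_pM2l Dy_gt0) -{1}[#|D y|%:R]ger0_norm// -normrM mulrBr.
  rewrite -sum_unif_expect !mulr_natl -[f s *+ _]sumr_const.
  rewrite -[_%:R *+ _]sumr_const -sumrB.
  apply: (le_trans (ler_norm_sum _ _ _)); apply: ler_sum => t tD.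
  exact: lip_crude sD tD.
have cardD : #|D x|%:R = #|E1|%:R + #|E2|%:R :> R.
  rewrite -natrD -(cardsID [set s : 'S_n | s x != y] (D x)).
  congr (_ + _)%:R; apply: eq_card => s; rewrite [LHS]inE [RHS]inE !inE.
    by rewrite andbC.
  by rewrite negbK andbC.
have split_sum : #|D x|%:R * (unif_expect (D x) f - m) =
    #|E1|%:R * (unif_expect E1 f - m) + \sum_(s in E2) (f s - m).
  rewrite !mulrBr -!sum_unif_expect sumrB sumr_const -[m *+ _]mulr_natl.
  have -> : \sum_(s in D x) f s = \sum_(s in E1) f s + \sum_(s in E2) f s.
    rewrite (bigID (fun s => s x != y)) /=; congr (_ + _);
    by apply: eq_bigl => s; rewrite [in RHS]inE ?negbK.
  by rewrite cardD; ring.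
rewrite -(ler_pM2l Dx_gt0) -{1}[#|D x|%:R]ger0_norm// -normrM split_sum.
apply: (le_trans (ler_normD _ _)).
have sum1 : `|#|E1|%:R * (unif_expect E1 f - m)| <= #|E1|%:R * 2.
  by rewrite normrM ger0_norm// ler_wpM2l.
have sum2 : `|\sum_(s in E2) (f s - m)| <= #|E2|%:R * #|A :\: P|%:R.
  apply: (le_trans (ler_norm_sum _ _ _)); rewrite mulr_natl -sumr_const.
  exact: ler_sum.
have := card_chord ax ay xP yP; rewrite -/E1 -/E2.
rewrite -(ler_nat R) natrD !natrM => chord.
have := ler0n R #|E1|; have := ler0n R #|E2|; rewrite cardD; lra.
Qed.

Lemma next_value_gap x y : D x != set0 -> D y != set0 ->
  `|unif_expect (D x) f - unif_expect (D y) f| <= 4.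
Proof.
have avail z : D z != set0 -> available z.
  move=> /set0Pn[s /DP[sA sP six]].
  have s_i : i \in moved s by rewrite sA.
  have sAP j : (s j \in A) = (j \in A) by rewrite -sA !inE (inj_eq perm_inj).
  split; first by rewrite -six sAP.
    by rewrite -six; rewrite inE in s_i.
  move=> p pP; rewrite -sP// -six (inj_eq perm_inj).
  by apply: contraNneq iP => <-.
move=> Dx0 Dy0; have ax := avail _ Dx0; have ay := avail _ Dy0.
have [xP|xP] := boolP (x \in P); have [yP|yP] := boolP (y \in P).
- apply: (unif_expect_involution (p := fun s => s * tperm x y)%g) => //.
  + exact: mul_tperm_involutive.
  + by move=> s sD; apply: mul_mem => //; left.
  + by move=> s sD; rewrite tpermC; apply: mul_mem => //; left.
  + move=> s sD; apply: (le_trans (lipD sD _ (hamming_mul_tperm s x y))).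
      by apply: mul_mem => //; left.
    by rewrite ler_nat.
- by rewrite distrC; apply: gap_mixed.
- exact: gap_mixed.
- apply: (unif_expect_involution (p := fun s => s ^ tperm x y)%g) => //.
  + exact: conj_tperm_involutive.
  + by move=> s sD; apply: conj_mem.
  + by move=> s sD; rewrite tpermC; apply: conj_mem.
  + move=> s sD; apply: (lipD sD _ (hamming_conj_tperm s x y)).
    exact: conj_mem.
Qed.

End OneMoreValue.

(** * Revealing the permutation *)

(** Each undetermined value costs [4 ^ 2]; when none is left, the cylinder has
at most one element. *)
Lemma subgaussian_cylinder A P pi :
    hamming_lipschitz [set s | moved s == A] -> P \subset A ->
  subgaussian (cylinder A P pi) f (#|A :\: P|%:R * 4 ^+ 2).
Proof.
move=> f_lip; have [k] := ubnP #|A :\: P|; elim: k P pi => // k IH P pi.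
rewrite ltnS => leAP PA.
have [AP0|/set0Pn[i]] := eqVneq (A :\: P) set0.
  have single s t : s \in cylinder A P pi -> t \in cylinder A P pi -> s = t.
    move=> /cylinderP[sA sP] /cylinderP[tA tP]; apply/permP => j.
    have [jP|jP] := boolP (j \in P); first by rewrite sP ?tP.
    have jA : j \notin A.
      by have := in_set0 j; rewrite -AP0 inE jP /= => ->.
    have: j \notin moved s by rewrite sA.
    have: j \notin moved t by rewrite tA.
    by rewrite !inE !negbK => /eqP -> /eqP ->.
  move=> l; rewrite AP0 cards0 mul0r mulr0 mul0r expR0 mulr1.
  rewrite -sumr_const; apply: ler_sum => s sD.
  have -> : cylinder A P pi = [set s].
    by apply/setP => t; rewrite inE; apply/idP/eqP => [/single/(_ sD)|->].
  by rewrite /unif_expect big_set1 cards1 divr1 subrr mulr0 expR0.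
rewrite inE => /andP[iP iA].
pose D x := [set s in cylinder A P pi | s i == x].
have cardAP : #|A :\: P| = #|A :\: (i |: P)|.+1.
  rewrite (cardsD1 i) inE iA iP add1n; congr _.+1.
  by apply: eq_card => j; rewrite !inE negb_or andbA.
rewrite cardAP -natr1 mulrDl mul1r.
apply: (@subgaussian_mixture _ _ _ (fun x => D x != set0) D _ _ 1) => //.
- by move=> x _; apply/subsetP => s /setIdP[].
- move=> s sD; rewrite -(cards1 (s i)); apply: eq_card => x.
  rewrite [LHS]inE [RHS]inE [s \in _]inE sD [x == _]eq_sym /=.
  rewrite andb_idl // => /eqP <-.
  by apply/set0Pn; exists s; rewrite inE sD eqxx.
- move=> x /set0Pn[t /setIdP[/cylinderP[tA tP] /eqP tix]].
  have -> : D x = cylinder A (i |: P) t.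
    apply/setP => s; rewrite inE; apply/andP/cylinderP.
      move=> [/cylinderP[sA sP] /eqP six]; split=> // j.
      by case/setU1P => [->|jP]; [rewrite six tix | rewrite sP// tP].
    move=> [sA sP]; split; last by rewrite sP ?tix// !inE eqxx.
    apply/cylinderP; split=> // j jP; rewrite sP ?tP//.
    by rewrite inE jP orbT.
  by apply: IH; [rewrite -cardAP | rewrite subUset sub1set iA].
- by move=> x y; apply: next_value_gap.
Qed.

(** Induction on the number [k - #|B|] of moved points still unknown. A
permutation is counted once for each of them, which is the multiplicity in
[subgaussian_mixture]; once all are known, the [k] values remain. *)
Lemma subgaussian_moved_supset k B :
    hamming_lipschitz (perms_of_weight n k) -> (#|B| <= k)%N ->
  subgaussian [set s in perms_of_weight n k | B \subset moved s] f
    ((k + (k - #|B|))%:R * 4 ^+ 2).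
Proof.
move=> f_lip; have [d] := ubnP (k - #|B|)%N; elim: d B => // d IH B.
rewrite ltnS => led; rewrite leq_eqVlt => /orP[/eqP Bk|Bk].
  have -> : [set s in perms_of_weight n k | B \subset moved s] =
      cylinder B set0 1%g.
    apply/setP => s; rewrite inE inE weightE.
    apply/andP/cylinderP => [[/eqP sk Bs]|[-> _]].
      split=> [|j]; last by rewrite inE.
      by apply/esym/eqP; rewrite eqEcard Bs sk Bk /=.
    by rewrite Bk eqxx subxx.
  rewrite Bk subnn addn0 -{1}Bk -[in #|B|](setD0 B).
  apply: subgaussian_cylinder; last exact: sub0set.
  by move=> s t; rewrite !inE => /eqP sB /eqP tB; apply: f_lip;
    rewrite inE weightE ?sB ?tB Bk.
have -> : (k + (k - #|B|) = (k + (k - #|B|.+1)).+1)%N by lia.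
rewrite -natr1 mulrDl mul1r.
pose D B' := [set s in perms_of_weight n k | B' \subset moved s].
apply: (@subgaussian_mixture _ _ _ (fun a => a \notin B)
  (fun a => D (a |: B)) _ _ (k - #|B|)); first by rewrite subn_gt0.
- move=> a _; apply/subsetP => s /setIdP[sk]; rewrite subUset inE sk.
  by case/andP.
- move=> s /setIdP[sk Bs]; rewrite -(_ : #|moved s| = k).
    rewrite -cardsDS//; apply: eq_card => a; rewrite !inE.
    by rewrite inE in sk; rewrite sk subUset sub1set inE Bs andbT.
  by move: sk; rewrite inE weightE => /eqP.
- move=> a aB; have cardaB : #|a |: B| = #|B|.+1 by rewrite cardsU1 aB.
  by rewrite -cardaB; apply: IH; rewrite cardaB// ; lia.
have swap a b s : a \notin B -> b \notin B ->
    s \in D (a |: B) -> (s ^ tperm a b)%g \in D (b |: B).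
  move=> aB bB; rewrite !inE !weightE => /andP[/eqP sk aBs].
  rewrite moved_conj card_imset ?sk ?eqxx/=; last exact: perm_inj.
  apply/subsetP => j jbB; apply/imsetP; exists (tperm a b j); last first.
    by rewrite tpermK.
  apply: (subsetP aBs); move: jbB; rewrite !inE => /orP[/eqP ->|jB].
    by rewrite tpermR eqxx.
  have aj : a != j by apply: contraNneq aB => ->.
  have bj : b != j by apply: contraNneq bB => ->.
  by rewrite tpermD// jB orbT.
move=> a b aB bB.
apply: (unif_expect_involution (p := fun s => s ^ tperm a b)%g) => //.
- exact: conj_tperm_involutive.
- by move=> s; apply: swap.
- by move=> s; rewrite tpermC; apply: swap.
- move=> s sD; apply: (@le_trans _ _ (hamming s (s ^ tperm a b)%g)%:R).
    apply: f_lip; first by case/setIdP: sD.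
    by case/setIdP: (swap _ _ _ aB bB sD).
  by rewrite ler_nat hamming_conj_tperm.
Qed.

End Lipschitz.
End Permutations.

Theorem lemma3p5 (R : realType) (n k : nat) (hk : (2 <= k <= n)%N)
  (f : 'S_n -> R)
  (hf : forall s t : 'S_n,
     s \in perms_of_weight n k -> t \in perms_of_weight n k ->
     `|f s - f t| <= (hamming s t)%:R)
  (t : R) (ht : 0 <= t) :
  unif_prob R (perms_of_weight n k)
    (fun s => t <= `|f s - unif_expect (perms_of_weight n k) f|)
  <= 2 * expR (- (t ^+ 2 / (72 * k%:R))).
Proof.
have k_gt0 : 0 < k%:R :> R by rewrite ltr0n; lia.
have f_lip : hamming_lipschitz f (perms_of_weight n k).
  by move=> s s'; exact: hf.
have := subgaussian_moved_supset f_lip (B := set0); rewrite cards0 => /(_ isT).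
have -> : [set s in perms_of_weight n k | set0 \subset moved s] =
    perms_of_weight n k.
  by apply/setP => s; rewrite [LHS]inE sub0set andbT.
set V := _ * _ => fV; have VE : V = 32 * k%:R.
  by rewrite /V subn0 natrD; ring.
have V_gt0 : 0 < V by rewrite VE mulr_gt0.
apply: (le_trans (subgaussian_two_sided_tail V_gt0 ht fV)).
rewrite ler_pM2l// ler_expR lerN2 ler_wpM2l ?sqr_ge0//.
have leV : 2 * V <= 72 * k%:R by rewrite VE; lra.
by rewrite lef_pV2 ?posrE; [exact: leV | exact: mulr_gt0 | exact: mulr_gt0].
Qed.
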